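(* Let $(c_i(r))_{i,r\ge0}$ and $(d_i(r))_{i,r\ge0}$ be the unique pair of double sequences satisfying: (a) $d_i(r)=0$ for all $i\ge2r+1$; (b) $d_{2r}(r)=\frac{1}{r+1}\binom{2r}{r}$ for all $r\ge 0$; (c) for each fixed $i$, $c_i(r)$ is polynomial in $r$, of degree $\le i$; (d) for each fixed $i$, $d_i(r)$ is polynomial in $r$, of degree $\le i$; (e) $c_i(r)=\sum_{j=0}^{2r-i}(-1)^j\binom{2r-j}{i}d_j(r)$ for all $i,r\ge 0$. Then, for all $i,r\ge0$, $$c_i(r)=\binom{r}{\lfloor i/2\rfloor}\binom{r}{\lfloor (i+1)/2\rfloor}\qquad\text{and}\qquad d_i(r)=\sum_{k=0}^{i}\binom{k}{i-k}\binom{r}{k}\mathcal{C}_k,$$ where $\mathcal{C}_k=\frac1{k+1}\binom{2k}{k}$ are the Catalan numbers.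
   Context: Binomial convention: for integers $a,b$, $\binom ab=0$ if $b<0$ or $0\le a<b$. An empty sum is $0$. Existence and uniqueness of the pair of sequences is part of a separate theorem of the paper. *)

(* Defs.v *)
From mathcomp Require Import all_boot all_order all_algebra.

Set Implicit Arguments.
Unset Strict Implicit.
Unset Printing Implicit Defensive.

Import Order.TTheory GRing.Theory Num.Theory.
Local Open Scope ring_scope.

Definition catalan (F : numFieldType) (k : nat) : F :=
  (k.+1)%:R^-1 * 'C(2 * k, k)%:R.

(* [size p <= m.+1] says that p = 0 or deg p <= m. *)
Definition poly_of_degree_le (F : numFieldType) (f : nat -> F) (m : nat) : Prop :=
  exists p : {poly F}, (size p <= m.+1)%N /\ forall r : nat, f r = p.[r%:R].

(* Double sequences are written index first: [c i r] is c_i(r).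
   In the last clause the index j runs over 0 <= j <= 2r - i; the truncated
   bound (2r + 1) - i is 0 when i > 2r, which gives the empty sum, and
   [2 * r - j] is never actually truncated. *)
Record admissible_pair (F : numFieldType) (c d : nat -> nat -> F) : Prop := {
  d_vanish : forall i r : nat, (2 * r + 1 <= i)%N -> d i r = 0;
  d_top : forall r : nat, d (2 * r)%N r = (r.+1)%:R^-1 * 'C(2 * r, r)%:R;
  c_poly : forall i : nat, poly_of_degree_le (c i) i;
  d_poly : forall i : nat, poly_of_degree_le (d i) i;
  c_from_d : forall i r : nat,
    c i r = \sum_(0 <= j < (2 * r).+1 - i)
              (-1) ^+ j * 'C(2 * r - j, i)%:R * d j r
}.

(* Main.v *)
Require Import Defs.
From mathcomp Require Import all_boot all_order all_algebra.
From mathcomp Require Import zify ring.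

(** Uniqueness: the difference of two admissible pairs satisfies (e) with
    [d_{2r}(r) = 0].  By induction on i, assume [c_j = d_j = 0] for [j < i].
    For [r < i] relation (e) gives [c_i(r) = 0]; for [r = i] the only possibly
    nonzero [c_k(i)] is the middle one, and [sum_k (-1)^k c_k(i) = d_{2i}(i) = 0]
    kills it.  So [c_i] has i + 1 roots and vanishes; then (e) for [c_{2r-i}(r)]
    reads [0 = +-d_i(r)] for [r <= i], and [d_i] vanishes too.

    Existence: (e) says [sum_i c_i(r) x^i = sum_j (-1)^j d_j(r) (1+x)^(2r-j)].
    For the explicit [d_j] the right-hand side is
    [sum_k C(r,k) Cat_k (-x)^k (1+x)^(2r-2k)].  As [Cat_k] is the difference of
    the coefficients of [w^k] and [w^(k+1)] in [(1+w)^(2k)], this is the difference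
    of the coefficients of [w^r] and [w^(r+1)] in
    [((1+x)^2 w - x (1+w)^2)^r = ((1 - x w) (w - x))^r], and expanding the
    factored form gives the explicit [c_i]. *)

Set Implicit Arguments.
Unset Strict Implicit.
Unset Printing Implicit Defensive.

Import Order.TTheory GRing.Theory Num.Theory.
Local Open Scope ring_scope.

Lemma sum_nat_truncate (V : nmodType) (f : nat -> V) m n :
  (n <= m)%N -> (forall k, (n <= k < m)%N -> f k = 0) ->
  \sum_(0 <= k < m) f k = \sum_(0 <= k < n) f k.
Proof.
move=> nm f0; rewrite (big_cat_nat _ (n := n)) //= [X in _ + X]big1_seq ?addr0 //.
by move=> k /=; rewrite mem_index_iota; apply: f0.
Qed.

(** * Functions on the naturals given by polynomials of bounded degree *)

Section PolynomialFunctions.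

Variable F : numFieldType.
Implicit Types (f g : nat -> F) (m n : nat).

Lemma poly_of_degree_le_eq0 f m :
  poly_of_degree_le f m -> (forall r, (r <= m)%N -> f r = 0) ->
  forall r, f r = 0.
Proof.
case=> p [sp fp] f0 r.
suff p0 : p = 0 by rewrite fp p0 horner0.
apply: (@roots_geq_poly_eq0 _ _ [seq k%:R | k <- iota 0 m.+1]).
- apply/allP => y /mapP[k]; rewrite mem_iota => /andP[_ km] ->.
  by rewrite /root -fp f0.
- by rewrite map_inj_uniq ?iota_uniq // => a b /eqP; rewrite eqr_nat => /eqP.
- by rewrite size_map size_iota.
Qed.

Lemma poly_of_degree_le_widen f m n :
  (m <= n)%N -> poly_of_degree_le f m -> poly_of_degree_le f n.
Proof. by move=> mn [p [sp fp]]; exists p; split=> //; apply: leq_trans sp _. Qed.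

Lemma poly_of_degree_leC (a : F) m : poly_of_degree_le (fun=> a) m.
Proof.
exists a%:P; split=> [|r]; last by rewrite hornerC.
exact: leq_trans (size_polyC_leq1 a) _.
Qed.

Lemma poly_of_degree_leD f g m :
  poly_of_degree_le f m -> poly_of_degree_le g m ->
  poly_of_degree_le (fun r => f r + g r) m.
Proof.
move=> [p [sp fp]] [q [sq gq]]; exists (p + q); split=> [|r].
  by rewrite (leq_trans (size_polyD _ _)) // geq_max sp.
by rewrite hornerD fp gq.
Qed.

Lemma poly_of_degree_leM f g m n :
  poly_of_degree_le f m -> poly_of_degree_le g n ->
  poly_of_degree_le (fun r => f r * g r) (m + n).
Proof.
move=> [p [sp fp]] [q [sq gq]]; exists (p * q); split=> [|r].
  by rewrite (leq_trans (size_polyMleq _ _)) //; lia.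
by rewrite hornerM fp gq.
Qed.

Lemma poly_of_degree_leB f g m :
  poly_of_degree_le f m -> poly_of_degree_le g m ->
  poly_of_degree_le (fun r => f r - g r) m.
Proof.
move=> [p [sp fp]] [q [sq gq]]; exists (p - q); split=> [|r].
  by rewrite (leq_trans (size_polyD _ _)) // geq_max sp size_polyN.
by rewrite hornerD hornerN fp gq.
Qed.

Lemma poly_of_degree_le_sum (h : nat -> nat -> F) m n :
  (forall k, (k < n)%N -> poly_of_degree_le (h k) m) ->
  poly_of_degree_le (fun r => \sum_(0 <= k < n) h k r) m.
Proof.
elim: n => [|n IHn] hP.
  have [p [sp fp]] := poly_of_degree_leC 0 m.
  by exists p; split=> // r; rewrite big_geq // -fp.
have [p [sp fp]] := poly_of_degree_leD (IHn (fun k kn => hP k (ltnW kn))) (hP n (ltnSn n)).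
by exists p; split=> // r; rewrite big_nat_recr //= -fp.
Qed.

Lemma poly_of_degree_le_bin k : poly_of_degree_le (fun r => 'C(r, k)%:R : F) k.
Proof.
elim: k => [|k [p [sp fp]]].
  have [p [sp fp]] := poly_of_degree_leC 1 0.
  by exists p; split=> // r; rewrite bin0 -fp.
exists (k.+1%:R^-1 *: (p * ('X - k%:R%:P))); split=> [|r].
  rewrite (leq_trans (size_scale_leq _ _)) // (leq_trans (size_polyMleq _ _)) //.
  by rewrite size_XsubC; lia.
rewrite hornerZ hornerM hornerXsubC -fp.
apply: (@mulfI _ (k.+1%:R)); first by rewrite pnatr_eq0.
rewrite mulVKf ?pnatr_eq0 // -natrM mul_bin_left natrM.
(* For [r < k] the truncated [r - k] is not the value of ['X - k] at [r], but then 'C(r, k) = 0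
   kills both sides. *)
have [kr|rk] := leqP k r; first by rewrite natrB // mulrC.
by rewrite bin_small // mulr0 mul0r.
Qed.

End PolynomialFunctions.

(** * Vanishing of a pair that satisfies the homogeneous conditions *)

Section Uniqueness.

Variables (F : numFieldType) (c d : nat -> nat -> F).
Hypothesis c_poly : forall i, poly_of_degree_le (c i) i.
Hypothesis d_poly : forall i, poly_of_degree_le (d i) i.
Hypothesis d_vanish : forall i r, (2 * r + 1 <= i)%N -> d i r = 0.
Hypothesis d_top0 : forall r, d (2 * r)%N r = 0.
Hypothesis c_from_d : forall i r,
  c i r = \sum_(0 <= j < (2 * r).+1 - i) (-1) ^+ j * 'C(2 * r - j, i)%:R * d j r.

(** Makes the range of [j] independent of [i], so that sums over [i] and [j] can be exchanged. *)
Lemma c_from_d_wide i r :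
  c i r = \sum_(j < (2 * r).+1) (-1) ^+ j * 'C(2 * r - j, i)%:R * d j r.
Proof.
rewrite c_from_d -(big_mkord xpredT (fun j => (-1) ^+ j * 'C(2 * r - j, i)%:R * d j r)).
apply/esym/sum_nat_truncate => [|j ji]; first by lia.
by rewrite bin_small ?mulr0 ?mul0r //; lia.
Qed.

Lemma sum_signed_bin n : (0 < n)%N ->
  \sum_(k < n.+1) (-1) ^+ k * 'C(n, k)%:R = 0 :> F.
Proof.
move=> n0; have := exprBn (1 : F) 1 n; rewrite subrr expr0n gtn_eqF // => E.
by rewrite [RHS]E; apply: eq_bigr => k _; rewrite !expr1n !mulr1 mulr_natr.
Qed.

(* Evaluation of [sum_k c_k(r) x^k = sum_j (-1)^j d_j(r) (1 + x)^(2r - j)]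
   at [x = -1]. *)
Lemma sum_signed_c r : \sum_(k < (2 * r).+1) (-1) ^+ k * c k r = d (2 * r) r.
Proof.
under eq_bigr => k _ do rewrite c_from_d_wide mulr_sumr.
(* The last index [j = 2r] contributes [d (2 * r) r] through 'C(0, k); for [j < 2r] the sum over [k]
   is an alternating row sum, hence 0. *)
rewrite exchange_big big_ord_recr /= [X in X + _]big1 ?add0r => [|j _].
  rewrite big_ord_recl big1 => [|k _]; rewrite subnn ?bin0n /=; last first.
    by rewrite mulr0 mul0r mulr0.
  by rewrite mulr1 !mul1r addr0 mul2n -signr_odd odd_double mul1r.
rewrite (eq_bigr (fun k : 'I_ _ => (-1) ^+ k * 'C(2 * r - j, k)%:R * ((-1) ^+ j * d j r))); last first.
  by move=> k _; ring.
rewrite -mulr_suml -(big_mkord xpredT (fun k => (-1) ^+ k * 'C(2 * r - j, k)%:R)).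
rewrite (@sum_nat_truncate _ _ _ (2 * r - j).+1) => [||k jk]; first last.
- by rewrite bin_small ?mulr0 //; lia.
- by lia.
by rewrite big_mkord sum_signed_bin ?mul0r //; have := ltn_ord j; lia.
Qed.

Lemma homogeneous_pair_eq0 i : (forall r, c i r = 0) /\ (forall r, d i r = 0).
Proof.
elim/ltn_ind: i => i IH.
have d_lt j r : (j < i)%N -> d j r = 0 by move=> /IH[].
(* Only [d j r] with j <= 2r - k < i enter [c k r]. *)
have c_far k r : (2 * r < k + i)%N -> c k r = 0.
  move=> rki; rewrite c_from_d big1_seq // => j /=; rewrite mem_index_iota => jk.
  by rewrite d_lt ?mulr0 //; lia.
have c_i r : c i r = 0.
  apply: poly_of_degree_le_eq0 (c_poly i) _ r => r ri.
  have [rlt|] := ltnP r i; first by apply: c_far; lia.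
  move=> ir; have {ir}ri : r = i by lia.
  rewrite {}ri {r}; have := sum_signed_c i; rewrite d_top0.
  have i2 : (i < (2 * i).+1)%N by lia.
  rewrite (bigD1 (Ordinal i2)) //= big1 ?addr0 => [/eqP|k /eqP ki].
    by rewrite mulf_eq0 signr_eq0 => /eqP.
  have {}ki : k != i :> nat by apply/eqP => e; apply: ki; apply: val_inj.
  have [/IH[->]|ik] := ltnP k i; first by rewrite mulr0.
  by rewrite c_far ?mulr0 //; lia.
split=> // r; apply: poly_of_degree_le_eq0 (d_poly i) _ r => r ri.
have [i2r|r2i] := leqP i (2 * r); last by apply: d_vanish; lia.
(* As r <= i, the index 2r - i is either [i] itself, just treated, or below [i]. *)
have : c (2 * r - i) r = 0.
  have [->|/eqP ne] := eqVneq (2 * r - i)%N i; first exact: c_i.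
  by have /IH[-> //] : (2 * r - i < i)%N by lia.
(* The sum now ends at [j = i], where the binomial coefficient is 1; the earlier terms vanish by
   induction. *)
rewrite c_from_d (_ : _ - _ = i.+1)%N; last by lia.
rewrite big_nat_recr //= big1_seq => [|j /=]; last first.
  by rewrite mem_index_iota => /andP[_ ji]; rewrite d_lt ?mulr0.
by rewrite add0r binn mulr1 => /eqP; rewrite mulf_eq0 signr_eq0 => /eqP.
Qed.

End Uniqueness.

(** * Two generating function identities over a commutative ring *)

Section GeneratingFunctions.

Variable R : comNzRingType.
Implicit Type x : R.

Lemma coef_linear_exp (a b : R) n k :
  ((a%:P + b *: 'X) ^+ n)`_k = 'C(n, k)%:R * (a ^+ (n - k) * b ^+ k).
Proof.
rewrite mulr_natl.
have E (i : nat) : (a%:P ^+ (n - i) * (b *: 'X) ^+ i *+ 'C(n, i))`_k =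
    (a ^+ (n - i) * b ^+ i *+ 'C(n, i)) * (k == i)%:R.
  by rewrite coefMn exprZn -rmorphXn coefCM coefZ coefXn mulrA mulrnAl.
rewrite exprDn coef_sum; have [kn|nk] := ltnP k n.+1.
  rewrite (bigD1 (Ordinal kn)) //= E eqxx mulr1 big1 ?addr0 // => i /eqP ik.
  by rewrite E (_ : (k == i) = false) ?mulr0 //; apply/eqP => e; apply: ik; apply: val_inj.
rewrite big1 ?bin_small // => i _; rewrite E (_ : (k == i) = false) ?mulr0 //.
by have := ltn_ord i; lia.
Qed.

(** The Catalan number as a natural number; by [bin_center_ge] the subtraction is not truncated. *)
Definition ballot (k : nat) : nat := 'C(2 * k, k) - 'C(2 * k, k.+1).

Lemma bin_center_ge k : ('C(2 * k, k.+1) <= 'C(2 * k, k))%N.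
Proof. by have := mul_bin_left (2 * k) k; nia. Qed.

Lemma mul_ballot k : (k.+1 * ballot k = 'C(2 * k, k))%N.
Proof.
rewrite mulnBr mul_bin_left (_ : 2 * k - k = k)%N; last by lia.
by rewrite mulSn addnK.
Qed.

Lemma sum_parity_split (f : nat -> R) n :
  \sum_(i < 2 * n) f i = \sum_(m < n) (f (2 * m)%N + f (2 * m).+1).
Proof.
elim: n => [|n IHn]; first by rewrite !big_ord0.
by rewrite (_ : 2 * n.+1 = (2 * n).+2)%N ?mulnS // !big_ord_recr /= IHn addrA.
Qed.

(** The polynomial variable of the proof is w, while [x] is a ring element, later specialized to
    ['X]. The upper bound 2r + 2 makes the exponents split evenly by parity; the extra term
    [i = 2r + 1] is zero. *)
Lemma ballot_expansion x r :
  \sum_(k < r.+1) ('C(r, k) * ballot k)%:R * (- x) ^+ k * (1 + x) ^+ (2 * (r - k)) =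
  \sum_(i < 2 * r.+1) ('C(r, i %/ 2) * 'C(r, (i + 1) %/ 2))%:R * x ^+ i.
Proof.
pose A : {poly R} := (1%:P + (- x) *: 'X) ^+ r.
pose B : {poly R} := ((- x)%:P + 1 *: 'X) ^+ r.
have AB : A * B = \sum_(k < r.+1)
    (('C(r, k)%:R * (- x) ^+ k * (1 + x) ^+ (2 * (r - k))) *:
       ('X^(r - k) * (1%:P + 1 *: 'X) ^+ (2 * k))).
  (* The identity (1 - x w)(w - x) = (1 + x)^2 w - x (1 + w)^2. *)
  rewrite -exprMn (_ : _ * _ = ((1 + x) ^+ 2)%:P * 'X + (- x)%:P * (1%:P + 1 *: 'X) ^+ 2).
    rewrite exprDn; apply: eq_bigr => k _; set W := 1%:P + 1 *: 'X.
    rewrite [(_ * 'X) ^+ _]exprMn [(_ * W ^+ 2) ^+ _]exprMn -!exprM.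
    rewrite -mul_polyC !rmorphM /= rmorph_nat !rmorphXn /= -mulr_natl.
    by rewrite -expr2 -exprM; ring.
  by rewrite -!mul_polyC !rmorphXn !rmorphD !rmorphN /=; ring.
have coefAB s : (A * B)`_s = \sum_(k < r.+1)
    ('C(r, k)%:R * (- x) ^+ k * (1 + x) ^+ (2 * (r - k))) *
      (if (s < r - k)%N then 0 else 'C(2 * k, s - (r - k))%:R).
  rewrite AB coef_sum; apply: eq_bigr => k _.
  by rewrite coefZ coefXnM coef_linear_exp !expr1n !mulr1.
transitivity ((A * B)`_r - (A * B)`_r.+1).
  rewrite !coefAB -sumrB; apply: eq_bigr => k _.
  have kr : (k <= r)%N by rewrite -ltnS.
  rewrite -mulrBr !ifF; [|lia|lia].
  rewrite (_ : r - (r - k) = k)%N; last by lia.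
  rewrite (_ : r.+1 - (r - k) = k.+1)%N; last by lia.
  by rewrite -natrB ?bin_center_ge // natrM; ring.
(* The coefficient of w^r yields the even powers of [x], that of w^(r+1) the odd ones; in the latter
   the first convolution term is 0 because [B] has degree r. *)
rewrite (sum_parity_split (fun i => ('C(r, i %/ 2) * 'C(r, (i + 1) %/ 2))%:R * x ^+ i)) big_split /= !coefM.
rewrite [X in _ - X]big_ord_recl /= !coef_linear_exp (bin_small (ltnSn r)) mul0r mulr0 add0r.
rewrite -sumrN; congr (_ + _); apply: eq_bigr => m _; rewrite !coef_linear_exp.
  have mr : (m <= r)%N by rewrite -ltnS.
  rewrite bin_sub // subKn // !expr1n (_ : 2 * m %/ 2 = m)%N; last by lia.
  rewrite (_ : (2 * m + 1) %/ 2 = m)%N; last by lia.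
  by rewrite mul1r mulr1 natrM mulrACA -exprD addnn -mul2n exprM sqrrN -exprM.
have mr : (m <= r)%N by rewrite -ltnS.
rewrite /bump /= !add1n subSS bin_sub // subKn // !expr1n.
rewrite (_ : (2 * m).+1 %/ 2 = m)%N; last by lia.
rewrite (_ : ((2 * m).+1 + 1) %/ 2 = m.+1)%N; last by lia.
rewrite mul1r mulr1 natrM mulrACA -exprD.
rewrite addSn addnn -mul2n.
by rewrite exprS exprM sqrrN -exprM [in RHS]exprS; ring.
Qed.

(** This is the binomial expansion of (-1)^k ((1 + x) - 1)^k with [j] shifted by [k]. The factor
    [(k <= j)] is needed since truncation would turn 'C(k, j - k) into 1 for [j < k]. *)
Lemma alternating_bin_exp x k n : (k <= n)%N ->
  \sum_(0 <= j < (2 * n).+1) (-1) ^+ j * ((k <= j)%N * 'C(k, j - k))%:R * (1 + x) ^+ (2 * n - j) =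
  (- x) ^+ k * (1 + x) ^+ (2 * (n - k)).
Proof.
move=> kn; rewrite (@sum_nat_truncate _ _ _ (2 * k).+1) => [||j ?]; first last.
- by rewrite bin_small ?muln0 ?mulr0 ?mul0r //; lia.
- by lia.
rewrite (big_cat_nat _ (n := k)) //=; last by lia.
rewrite big1_seq ?add0r => [|j /=]; last first.
  by rewrite mem_index_iota => /andP[_ jk]; rewrite leqNgt jk /= mulr0 mul0r.
rewrite -{1}[k]add0n big_addn big_mkord (_ : _ - k = k.+1)%N; last by lia.
rewrite (_ : (- x) ^+ k = (-1) ^+ k * ((1 + x) - 1) ^+ k); last first.
  by rewrite addrAC subrr add0r -exprMn mulN1r.
rewrite exprBn mulr_sumr mulr_suml; apply: eq_bigr => s _.
have sk : (s <= k)%N by rewrite -ltnS.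
rewrite leq_addl mul1n addnK expr1n mulr1 exprD -mulr_natl.
rewrite (_ : 2 * n - (s + k) = (k - s) + 2 * (n - k))%N; last by lia.
by rewrite exprD; ring.
Qed.

End GeneratingFunctions.

(** * The explicit formulas form an admissible pair *)

Section ExplicitPair.

Variable F : numFieldType.

Definition explicit_c (i r : nat) : F :=
  'C(r, i %/ 2)%:R * 'C(r, (i + 1) %/ 2)%:R.

Definition explicit_d (i r : nat) : F :=
  \sum_(0 <= k < i.+1) 'C(k, i - k)%:R * 'C(r, k)%:R * catalan F k.

Lemma catalan_ballot k : catalan F k = (ballot k)%:R.
Proof. by rewrite /catalan -mul_ballot natrM mulKf // pnatr_eq0. Qed.

(** The range of [k] no longer depends on [i], as the exchange of sums in
    [explicit_generating_function] requires. *)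
Lemma explicit_d_wide i r : explicit_d i r =
  \sum_(k < r.+1) ((k <= i)%N * 'C(k, i - k))%:R * ('C(r, k) * ballot k)%:R.
Proof.
pose f k : F := ((k <= i)%N * 'C(k, i - k))%:R * ('C(r, k) * ballot k)%:R.
rewrite -(big_mkord xpredT f) -(@sum_nat_truncate _ f (r.+1 + i.+1)); first last.
- by move=> k kr; rewrite /f (@bin_small r) ?mulr0 //; lia.
- by lia.
rewrite (@sum_nat_truncate _ f _ i.+1) => [||k ik]; first last.
- by rewrite /f (_ : (k <= i)%N = false) ?mul0r //; lia.
- by lia.
rewrite /explicit_d !big_mkord; apply: eq_bigr => k _.
by rewrite /f -ltnS ltn_ord mul1n catalan_ballot natrM mulrA.
Qed.

Lemma explicit_d_vanish i r : (2 * r + 1 <= i)%N -> explicit_d i r = 0.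
Proof.
move=> ri; rewrite explicit_d_wide big1 // => k _.
by rewrite bin_small ?muln0 ?mul0r //; have := ltn_ord k; lia.
Qed.

Lemma explicit_d_top r : explicit_d (2 * r) r = catalan F r.
Proof.
rewrite explicit_d_wide big_ord_recr /= big1 => [|k _].
  rewrite add0r (_ : (r <= 2 * r)%N); last by lia.
  by rewrite (_ : 2 * r - r = r)%N ?binn ?mul1n ?mul1r ?catalan_ballot //; lia.
by rewrite (@bin_small k) ?muln0 ?mul0r //; have := ltn_ord k; lia.
Qed.

Lemma explicit_c_poly i : poly_of_degree_le (explicit_c i) i.
Proof.
apply: (@poly_of_degree_le_widen _ _ (i %/ 2 + (i + 1) %/ 2)); first by lia.
by apply: poly_of_degree_leM; apply: poly_of_degree_le_bin.
Qed.

Lemma explicit_d_poly i : poly_of_degree_le (explicit_d i) i.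
Proof.
apply: poly_of_degree_le_sum => k ki.
apply: (@poly_of_degree_le_widen _ _ (0 + k + 0)); first by lia.
apply: poly_of_degree_leM; last exact: poly_of_degree_leC.
by apply: poly_of_degree_leM; [apply: poly_of_degree_leC | apply: poly_of_degree_le_bin].
Qed.

Lemma explicit_generating_function r :
  \sum_(0 <= j < (2 * r).+1) ((-1) ^+ j * explicit_d j r) *: (1 + 'X) ^+ (2 * r - j) =
  \sum_(i < 2 * r.+1) explicit_c i r *: 'X^i :> {poly F}.
Proof.
under [RHS]eq_bigr => i _ do rewrite /explicit_c -natrM -mul_polyC rmorph_nat.
rewrite -ballot_expansion.
under eq_bigr => j _ do rewrite explicit_d_wide mulr_sumr scaler_suml.
rewrite big_mkord exchange_big /=; apply: eq_bigr => k _.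
have kr : (k <= r)%N by rewrite -ltnS.
rewrite -mulrA -(alternating_bin_exp _ kr) mulr_sumr big_mkord.
apply: eq_bigr => j _.
rewrite -mul_polyC !rmorphM /= !rmorph_nat rmorphXn rmorphN1.
by ring.
Qed.

Lemma coef_one_plus_X_exp n i : ((1 + 'X) ^+ n : {poly F})`_i = 'C(n, i)%:R.
Proof.
by have := coef_linear_exp (1 : F) 1 n i; rewrite scale1r !expr1n !mulr1.
Qed.

(** Compares the coefficients of X^i in [explicit_generating_function]; the terms with j > 2r - i
    have coefficient 0. *)
Lemma explicit_c_from_d i r : explicit_c i r =
  \sum_(0 <= j < (2 * r).+1 - i)
    (-1) ^+ j * 'C(2 * r - j, i)%:R * explicit_d j r.
Proof.
have := congr1 (fun p : {poly F} => p`_i) (explicit_generating_function r).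
rewrite !coef_sum /= => E.
transitivity (\sum_(k < 2 * r.+1) (explicit_c k r *: 'X^k : {poly F})`_i).
  under eq_bigr => k _ do rewrite coefZ coefXn.
  have [ir|ri] := ltnP i (2 * r.+1).
    rewrite (bigD1 (Ordinal ir)) //= eqxx mulr1 big1 ?addr0 // => k /eqP ki.
    by rewrite (_ : (i == k) = false) ?mulr0 //; apply/eqP => e; apply: ki; apply: val_inj.
  rewrite /explicit_c bin_small ?mul0r ?big1 // => [k _|]; last by lia.
  by rewrite (_ : (i == k) = false) ?mulr0 //; have := ltn_ord k; lia.
rewrite -{}E (@sum_nat_truncate _ _ _ ((2 * r).+1 - i)) => [||j ji]; first last.
- by rewrite coefZ coef_one_plus_X_exp bin_small ?mulr0 //; lia.
- by lia.
by apply: eq_bigr => j _; rewrite coefZ coef_one_plus_X_exp mulrAC.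
Qed.

Lemma explicit_admissible : admissible_pair explicit_c explicit_d.
Proof.
split.
- exact: explicit_d_vanish.
- exact: explicit_d_top.
- exact: explicit_c_poly.
- exact: explicit_d_poly.
- exact: explicit_c_from_d.
Qed.

End ExplicitPair.

(** * Uniqueness of admissible pairs and the conclusion *)

Lemma admissible_pair_unique (F : numFieldType) (c d c' d' : nat -> nat -> F) :
  admissible_pair c d -> admissible_pair c' d' ->
  forall i r, c i r = c' i r /\ d i r = d' i r.
Proof.
move=> [dv dt cp dp cd] [dv' dt' cp' dp' cd'] i r.
have [||j s sj|s|j s|ci di] := @homogeneous_pair_eq0 F
  (fun j s => c j s - c' j s) (fun j s => d j s - d' j s) _ _ _ _ _ i.
- by move=> j; apply: poly_of_degree_leB.
- by move=> j; apply: poly_of_degree_leB.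
- by rewrite dv // dv' // subrr.
- by rewrite dt dt' subrr.
- by rewrite cd cd' -sumrB; apply: eq_bigr => k _; rewrite mulrBr.
by split; apply/eqP; rewrite -subr_eq0 ?ci ?di.
Qed.

Theorem mainTheorem8 (F : numFieldType) (c d : nat -> nat -> F)
    (hcd : admissible_pair c d) (i r : nat) :
  c i r = 'C(r, i %/ 2)%:R * 'C(r, (i + 1) %/ 2)%:R /\
  d i r = \sum_(0 <= k < i.+1) 'C(k, i - k)%:R * 'C(r, k)%:R * catalan F k.
Proof. exact: admissible_pair_unique hcd (explicit_admissible F) i r. Qed.
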